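(* Let $\alpha>0$, $\beta>0$, $t\ge0$. For every integer $n\ge0$, the off-diagonal recurrence coefficient $\beta_n$ of the monic orthogonal polynomials for the weight $w(x)=e^{-t/x}x^\alpha(1-x)^\beta$ on $[0,1]$ satisfies $$\{1-(2n+\alpha+\beta)^2\}\,\beta_n=-(r_n^*-r_n)^2-(\beta+t)r_n+(t-\alpha-2n)r_n^*+nt,$$ where $r_n,r_n^*$ are defined in the context.
   Context: $P_n$ is the monic polynomial of degree $n$ with $\int_0^1P_mP_nw\,dx=h_n\delta_{m,n}$. The recurrence coefficients $\alpha_n,\beta_n$ (not to be confused with the parameters $\alpha,\beta$) are defined by $xP_n(x)=P_{n+1}(x)+\alpha_nP_n(x)+\beta_nP_{n-1}(x)$, with $P_0=1$, $\beta_0P_{-1}=0$ (so $\beta_n=h_n/h_{n-1}$ for $n\ge1$ and $\beta_0=0$). Auxiliary quantities: $r_n^*:=\frac{t}{h_{n-1}}\int_0^1P_{n-1}(y)P_n(y)w(y)\frac{dy}{y}$, $r_n:=\frac{\beta}{h_{n-1}}\int_0^1P_{n-1}(y)P_n(y)w(y)\frac{dy}{1-y}$, with $r_0=r_0^*:=0$. *)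

(* Defs.v *)
From HB Require Import structures.
From mathcomp Require Import all_boot all_order all_algebra.
From mathcomp Require Import all_classical all_reals all_analysis.

Set Implicit Arguments.
Unset Strict Implicit.
Unset Printing Implicit Defensive.

Import Order.TTheory GRing.Theory Num.Theory.
Import numFieldNormedType.Exports.

Local Open Scope classical_set_scope.
Local Open Scope ring_scope.

(* The values at x = 0 and x = 1, where the formulas below may involve a
   division by zero, have no effect on Lebesgue integrals. *)

Definition weight (R : realType) (alpha beta t x : R) : R :=
  expR (- t / x) * x `^ alpha * (1 - x) `^ beta.

Definition integral01 (R : realType) (f : R -> R) : R :=
  \int[@lebesgue_measure R]_(x in `[0, 1]) f x.

Definition monic_orthogonal (R : realType) (w : R -> R)
    (P : nat -> {poly R}) (h : nat -> R) : Prop :=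
  (forall n, P n \is monic /\ size (P n) = n.+1) /\
  (forall m n, integral01 (fun x => (P m).[x] * (P n).[x] * w x) =
               if m == n then h n else 0).

(* P_{-1} := 0, so that beta_0 P_{-1} = 0; beta_0 itself is fixed to be 0. *)
Definition recurrence_coefficients (R : realType) (P : nat -> {poly R})
    (a b : nat -> R) : Prop :=
  b 0%N = 0 /\
  forall n, 'X * P n =
    P n.+1 + a n *: P n + b n *: (if n is m.+1 then P m else 0).

Definition r_star (R : realType) (alpha beta t : R)
    (P : nat -> {poly R}) (h : nat -> R) (n : nat) : R :=
  if n is m.+1 then
    t / h m * integral01
      (fun y => (P m).[y] * (P n).[y] * weight alpha beta t y / y)
  else 0.

Definition r_aux (R : realType) (alpha beta t : R)
    (P : nat -> {poly R}) (h : nat -> R) (n : nat) : R :=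
  if n is m.+1 then
    beta / h m * integral01
      (fun y => (P m).[y] * (P n).[y] * weight alpha beta t y / (1 - y))
  else 0.

(* Main.v *)
(* Integrating the derivative of x f(x) w(x) over [0, 1] and using
     x w'/w = alpha + beta + t/x - beta/(1 - x)
   gives a linear relation between the moments of w, w/x and w/(1 - x).  Write
   P_n = x^n + p_n x^(n-1) + s_n x^(n-2) + ... and K = 2n + alpha + beta.
   - f = P_{n-1} P_n gives r*_n - r_n = p_n.
   - f = x P_{n-1} P_n gives r_n = (K + 1) beta_n + p_n^2 - 2 s_n.
   - f = x P_j^2 and f = x^2 P_j^2 both compute beta int P_j^2 w/(1 - x) / h_j;
     the difference of the two results telescopes, and summing over j < n gives
     K (p_n^2 - 2 s_n + beta_n)
       = (t + beta) p_n - p_n^2 - K p_n + n t - beta_n.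
   Eliminating p_n and s_n from these three identities yields the claim. *)

Require Import Defs.
From HB Require Import structures.
From mathcomp Require Import all_boot all_order all_algebra.
From mathcomp Require Import all_classical all_reals all_analysis.
From mathcomp Require Import measurable_realfun.
From mathcomp Require Import zify ring lra.

Import Order.TTheory GRing.Theory Num.Theory.
Import numFieldNormedType.Exports.

Local Open Scope classical_set_scope.
Local Open Scope ring_scope.

(** * Coefficients of shifted polynomials and of their derivatives *)

Lemma coefX_X2 (K : nzRingType) (p : {poly K}) i : ('X * p)`_i = ('X^2 * p)`_i.+1.
Proof. by rewrite expr2 -mulrA [RHS]coefXM. Qed.

(** For i > 0 both sides are i - 1 times the coefficient of p of index i - 1. At i = 0 the factor is
    -1, but the coefficient it multiplies vanishes. *)
Lemma coefX2deriv (K : comNzRingType) (p : {poly K}) i :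
  ('X^2 * p^`())`_i = (i%:R - 1) * ('X^2 * p)`_i.+1.
Proof.
have := coef_deriv ('X^2 * p) i.
have -> : ('X^2 * p)^`() = 2%:R *: ('X * p) + 'X^2 * p^`().
  by rewrite derivM derivXn -mul_polyC polyC_natr /= -mulr_natl mulrA.
rewrite coefD coefZ coefX_X2 -mulr_natr => /(canRL (addKr _)) ->.
by rewrite -natr1; ring.
Qed.

(** Closes a goal that is a multiple of a known equation, leaving to [ring] the comparison of the
    differences. *)
Lemma eq_of_multiple (K : pzRingType) (c x y u v : K) :
  u = v -> x - y = c * (u - v) -> x = y.
Proof. by move=> -> /eqP; rewrite subrr mulr0 subr_eq0 => /eqP. Qed.

(** * The algebra: the identity derived from abstract moment functionals *)

(* [L f], [E f] and [D f] stand for the integrals of [f w], [f w / y] and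
   [f w / (1 - y)]. *)
Section RecurrenceFromMoments.
Variables (K : fieldType) (L E D : {scalar {poly K}}) (alpha beta t : K).
Hypothesis by_parts : forall f,
  L ('X * f)^`() = - (alpha + beta) * L f - t * E f + beta * D f.
Hypothesis EX : forall f, E ('X * f) = L f.
Hypothesis DX : forall f, D ('X * f) = D f - L f.

Variables (P : nat -> {poly K}) (h a b : nat -> K).
Hypothesis P_monic : forall n, P n \is monic.
Hypothesis size_P : forall n, size (P n) = n.+1.
Hypothesis P_orth : forall m n, L (P m * P n) = if m == n then h n else 0.
Hypothesis b0 : b 0%N = 0.
Hypothesis P_rec : forall n,
  'X * P n = P n.+1 + a n *: P n + b n *: (if n is m.+1 then P m else 0).
Hypothesis h_neq0 : forall n, h n != 0.

(* The two coefficients of [P n] after the leading one; the factor ['X^2]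
   makes them vanish when the degree is too small. *)
Let p n := ('X^2 * P n)`_n.+1.
Let s n := ('X^2 * P n)`_n.

Let lead n : (P n)`_n = 1.
Proof. by have /monicP := P_monic n; rewrite lead_coefE size_P. Qed.

Let coef_gt n i : (n < i)%N -> (P n)`_i = 0.
Proof. by move=> ni; rewrite nth_default// size_P. Qed.

Let coefp n : (P n.+1)`_n = p n.+1.
Proof. by rewrite /p expr2 -mulrA !coefXM. Qed.

Let coefs n : (P n.+2)`_n = s n.+2.
Proof. by rewrite /s expr2 -mulrA !coefXM. Qed.

Let X2lead n : ('X^2 * P n)`_n.+2 = 1.
Proof. by rewrite expr2 -mulrA !coefXM/= lead. Qed.

Let X2gt n i : (n.+2 < i)%N -> ('X^2 * P n)`_i = 0.
Proof. by case: i => [//|[//|i]] ni; rewrite expr2 -mulrA !coefXM/= coef_gt. Qed.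

Let p0 : p 0 = 0.
Proof. by rewrite /p coefXnM. Qed.

Let s0 : s 0 = 0.
Proof. by rewrite /s coefXnM. Qed.

Let X2rec n : 'X * ('X^2 * P n) =
  'X^2 * P n.+1 + a n *: ('X^2 * P n) +
  b n *: ('X^2 * (if n is m.+1 then P m else 0)).
Proof. by rewrite mulrCA P_rec !mulrDr !scalerAr. Qed.

Let p_rec n : p n.+1 = p n - a n.
Proof.
have := congr1 (fun q : {poly K} => q`_n.+2) (X2rec n).
rewrite coefXM/= !coefD !coefZ X2lead -/(p n) -/(p n.+1).
case: n => [|n]; first by rewrite b0 => ->; ring.
by rewrite X2gt// => ->; ring.
Qed.

Let s_rec n : s n.+1 = s n - a n * p n - b n.
Proof.
have := congr1 (fun q : {poly K} => q`_n.+1) (X2rec n).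
rewrite coefXM/= !coefD !coefZ -/(p n) -/(s n) -/(s n.+1).
case: n => [|n]; first by rewrite b0 => ->; ring.
by rewrite X2lead => ->; ring.
Qed.

Let size_sub_lead (q : {poly K}) k :
  (size q <= k.+1)%N -> (size (q - q`_k *: P k)%R <= k)%N.
Proof.
move=> /leq_sizeP qk; apply/leq_sizeP => i; rewrite leq_eqVlt => /predU1P[<-|ki].
  by rewrite coefB coefZ lead mulr1 subrr.
by rewrite coefB coefZ (qk _ ki) (coef_gt _ _ ki) mulr0 subrr.
Qed.

(** Multiples of [P k] with k < n are peeled off from the top degree down; each is orthogonal to
    [P n]. *)
Let L_low n (q : {poly K}) : (size q <= n)%N -> L (q * P n) = 0.
Proof.
suff H k : (k <= n)%N -> forall q : {poly K}, (size q <= k)%N -> L (q * P n) = 0.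
  exact: H.
elim: k => [_ {}q|k IH kn {}q qk].
  by rewrite leqn0 size_poly_eq0 => /eqP ->; rewrite mul0r linear0.
rewrite -[q](subrK (q`_k *: P k)) mulrDl linearD/= IH ?(ltnW kn) ?size_sub_lead//.
by rewrite -scalerAl linearZ/= P_orth (ltn_eqF kn) mulr0 addr0.
Qed.

(** Only the component of q along [P n] counts. Removing the components along [P n.+2] and then
    [P n.+1] turns the coefficient of index n into the stated combination; the remainder falls under
    [L_low]. *)
Let L_expand n (q : {poly K}) : (size q <= n.+3)%N ->
  L (q * P n) =
  (q`_n - q`_n.+1 * p n.+1 - q`_n.+2 * (s n.+2 - p n.+2 * p n.+1)) * h n.
Proof.
pose red (k : nat) (f : {poly K}) := f - f`_k *: P k.
have L_red k f : L (f * P n) = f`_k * L (P k * P n) + L (red k f * P n).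
  by rewrite /red mulrBl linearB/= -scalerAl linearZ/=; ring.
move=> qn.
have q1 := size_sub_lead _ _ qn; have q2 := size_sub_lead _ _ q1.
rewrite (L_red n.+2 q) (L_red n.+1 (red _ _)) (L_red n (red _ (red _ _))).
rewrite !P_orth L_low; last exact: size_sub_lead.
rewrite eqxx (gtn_eqF (leqnSn n.+1)) (gtn_eqF (leqnn n.+1)).
rewrite /red !(coefB, coefZ) !coefp coefs.
ring.
Qed.

Let size_XnP k n m : (k + n < m)%N -> (size ('X^k * P n)%R <= m)%N.
Proof.
by move=> knm; rewrite size_monicM ?monicXn ?monic_neq0// size_polyXn size_P addnS.
Qed.

Let size_XndP k n m : (k + n <= m)%N -> (size ('X^k * (P n)^`())%R <= m)%N.
Proof.
move=> /(leq_trans _); apply; apply: leq_trans (size_polyMleq _ _) _.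
rewrite size_polyXn addSn/= leq_add2l.
by rewrite -ltnS -(size_P n) lt_size_deriv// monic_neq0.
Qed.

Let LPP n : L (P n * P n) = h n.
Proof. by rewrite P_orth eqxx. Qed.

Let LXPP n : L ('X * P n * P n) = (p n - p n.+1) * h n.
Proof.
rewrite L_expand; last by apply: (size_XnP 1); lia.
by rewrite !coefX_X2 X2lead (X2gt n n.+3)// -/(p n); ring.
Qed.

Let LX2PP n : L ('X^2 * P n * P n) =
  (s n - p n * p n.+1 - (s n.+2 - p n.+2 * p n.+1)) * h n.
Proof.
rewrite L_expand; last by apply: size_XnP; lia.
by rewrite X2lead -/(p n) -/(s n); ring.
Qed.

Let LX2dPP n : L ('X^2 * (P n)^`() * P n) =
  ((n%:R - 1) * p n - n%:R * p n.+1) * h n.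
Proof.
rewrite L_expand; last by apply: size_XndP; lia.
rewrite !coefX2deriv X2lead (X2gt n n.+3)// -/(p n) -natr1; ring.
Qed.

Let LX3dPP n : L ('X^3 * (P n)^`() * P n) =
  ((n%:R - 2) * s n - (n%:R - 1) * p n * p n.+1
   - n%:R * (s n.+2 - p n.+2 * p n.+1)) * h n.
Proof.
rewrite L_expand; last by apply: size_XndP; lia.
rewrite exprS -mulrA !coefXM !coefX2deriv X2lead -/(p n) -/(s n).
case: n => [|n]; rewrite /= ?coefX2deriv -!natr1 -/(p _) -/(s _); last by ring.
by rewrite s0; ring.
Qed.

Let coefXderiv (f : {poly K}) i : ('X * f^`())`_i = i%:R * f`_i.
Proof.
by rewrite coefXM; case: i => [|i]/=; rewrite ?mul0r// coef_deriv -[LHS]mulr_natl.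
Qed.

Let derivX (f : {poly K}) : ('X * f)^`() = f + 'X * f^`().
Proof. by rewrite derivM derivX mul1r. Qed.

(** With f = X g, the extra factor x turns w/x into w and x/(1 - x) into 1/(1 - x) - 1. *)
Let by_parts2 g : L ('X * ('X * g))^`() =
  - (alpha + beta) * L ('X * g) - t * L g + beta * (D g - L g).
Proof. by rewrite by_parts EX DX. Qed.

Let by_parts3 g : L ('X * ('X * ('X * g)))^`() =
  - (alpha + beta) * L ('X * ('X * g)) - t * L ('X * g)
  + beta * (D g - L g - L ('X * g)).
Proof. by rewrite by_parts2 DX. Qed.

(* [D (P_n^2)] enters the by-parts identities for [X^2 P_n^2] and
   [X^3 P_n^2]; eliminating it leaves a relation between consecutive
   coefficients. *)
Let step n :
  let V := s n - p n * p n.+1 - (s n.+2 - p n.+2 * p n.+1) in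
  let W := (n%:R - 2) * s n - (n%:R - 1) * p n * p n.+1
           - n%:R * (s n.+2 - p n.+2 * p n.+1) in
  3 * V + 2 * W + (alpha + beta) * V + (t + beta) * (p n - p n.+1) =
  2 * (p n - p n.+1) + 2 * ((n%:R - 1) * p n - n%:R * p n.+1)
  + (alpha + beta) * (p n - p n.+1) + t.
Proof.
move=> V W; apply: (mulIf (h_neq0 n)).
have := by_parts2 (P n * P n); have := by_parts3 (P n * P n).
have -> : ('X * ('X * ('X * (P n * P n))))^`() =
  3 *: ('X^2 * P n * P n) + 2 *: ('X^3 * (P n)^`() * P n).
  by rewrite !derivX derivM -!mul_polyC !polyC_natr; ring.
have -> : ('X * ('X * (P n * P n)))^`() =
  2 *: ('X * P n * P n) + 2 *: ('X^2 * (P n)^`() * P n).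
  by rewrite !derivX derivM -!mul_polyC !polyC_natr; ring.
rewrite !linearD !linearZ/= !mulrA -expr2.
rewrite LXPP LX2PP LX2dPP LX3dPP LPP -/V -/W.
move=> e3 e2; have e := congr2 (fun x y => x - y) e3 e2.
by apply: (eq_of_multiple _ 1 _ _ _ _ e); ring.
Qed.

(** By induction: after [p_rec] and [s_rec], [step n] is exactly the difference of the identities at
    n + 1 and n, and both sides vanish at n = 0. *)
Let telescoped n :
  (2 * n%:R + alpha + beta) * (p n ^+ 2 - 2 * s n + b n) =
  (t + beta) * p n - p n ^+ 2 - (2 * n%:R + alpha + beta) * p n
  + n%:R * t - b n.
Proof.
elim: n => [|n IH]; first by rewrite p0 s0 b0; ring.
(* Here [a n.+1] cancels: s_(n+2) - p_(n+2) p_(n+1) = s_(n+1) - p_(n+1)^2 - b_(n+1). *)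
have := step n; rewrite /= (p_rec n.+1) (s_rec n.+1) !(p_rec n) !(s_rec n).
move=> st; have e := congr2 +%R IH st.
by apply: (eq_of_multiple _ 1 _ _ _ _ e); rewrite -natr1; ring.
Qed.

Let LXPnPm n : L ('X * P n.+1 * P n) = b n.+1 * h n.
Proof.
rewrite P_rec !mulrDl -!scalerAl !linearD !linearZ/= !P_orth eqxx.
by rewrite (gtn_eqF (leqnSn n.+1)) (gtn_eqF (leqnn n.+1)); ring.
Qed.

(** The integral of x P_(n+1) P_n is read in two ways: by the recurrence for [P n.+1], and as
    ['X * P n], monic of degree n + 1, against [P n.+1]. *)
Let hE n : h n.+1 = b n.+1 * h n.
Proof.
rewrite -LXPnPm mulrAC L_expand.
  by rewrite !coefXM/= lead !coef_gt//; ring.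
by apply: (size_XnP 1); lia.
Qed.

(** Stated for arbitrary functionals over a field, so that analysis enters only through the section
    hypotheses. *)
Lemma orthogonal_recurrence n :
  let r := if n is m.+1 then beta / h m * D (P m * P n) else 0 in
  let rs := if n is m.+1 then t / h m * E (P m * P n) else 0 in
  (1 - (2 * n%:R + alpha + beta) ^+ 2) * b n =
  - (rs - r) ^+ 2 - (beta + t) * r + (t - alpha - 2 * n%:R) * rs + n%:R * t.
Proof.
case: n => [|m]; first by rewrite /= b0; ring.
set n := m.+1 => r rs.
have mr : beta * D (P m * P n) = r * h m by rewrite /r; field; exact: h_neq0.
have mrs : t * E (P m * P n) = rs * h m by rewrite /rs; field; exact: h_neq0.
have Lmn : L (P m * P n) = 0 by rewrite P_orth ltn_eqF.
have nE : n%:R = m%:R + 1 :> K by rewrite natr1.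
(* Integration by parts with f = P_m P_n. The term with P_m' has degree below n and drops out; the
   one with P_n' gives m p_n - n p_n = -p_n, times h_m. *)
have rsE : rs = r + p n.
  apply: (mulIf (h_neq0 m)).
  have := by_parts (P m * P n).
  have -> : ('X * (P m * P n))^`() = P m * P n + 'X * (P m)^`() * P n
     + 'X * (P n)^`() * P m by rewrite derivX derivM; ring.
  rewrite !linearD/= Lmn mr mrs (L_low _ _ (size_XndP 1 _ _ (leqnn _))).
  rewrite L_expand; last by apply: (size_XndP 1); lia.
  rewrite !coefXderiv coefp lead coef_gt// -natr1 -/n => e.
  by apply: (eq_of_multiple _ 1 _ _ _ _ e); ring.
(* Now f = X P_m P_n. In units of h_m, the terms with P_m' and P_n' give m b_n and n b_n + p_n^2 - 2
   s_n, and the undifferentiated one 2 b_n. *)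
have rE : r = (2 * n%:R + alpha + beta + 1) * b n + p n ^+ 2 - 2 * s n.
  apply: (mulIf (h_neq0 m)).
  have := by_parts2 (P m * P n).
  have -> : ('X * ('X * (P m * P n)))^`() = 2 *: ('X * P n * P m)
      + 'X^2 * (P m)^`() * P n + 'X^2 * (P n)^`() * P m.
    by rewrite !derivX derivM -mul_polyC polyC_natr; ring.
  rewrite !linearD linearZ/= Lmn.
  have -> : 'X * (P m * P n) = 'X * P n * P m by ring.
  rewrite LXPnPm (L_expand n); last by apply: size_XndP; lia.
  rewrite (L_expand m); last by apply: size_XndP; lia.
  rewrite !coefX2deriv !X2lead (X2gt m n.+2)// (X2gt m n.+3)// -/(p n) -/(s n).
  rewrite (mulrBr beta) mr hE -(natr1 n.+1) -(natr1 n) -[m.+1]/n.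
  rewrite (s_rec n) (p_rec n) => e.
  by apply: (eq_of_multiple _ (-1) _ _ _ _ e); rewrite nE; ring.
(* Put K = 2n + alpha + beta. Substituting rs = r + p_n leaves r with coefficient -K, and r = K b_n
   + (p_n^2 - 2 s_n + b_n); the K^2 b_n cancels and [telescoped] remains. *)
by apply: (eq_of_multiple _ 1 _ _ _ _ (telescoped n)); rewrite rsE rE; ring.
Qed.

End RecurrenceFromMoments.

(** * The fundamental theorem of calculus with derivatives unbounded at the endpoints *)

Lemma is_derive_continuous (R : realType) (f : R -> R) (x df : R) :
  is_derive x 1 f df -> {for x, continuous f}.
Proof. by case=> ? _; exact/differentiable_continuous/derivable1_diffP. Qed.

Section ImproperFTC.
Variable R : realType.
Notation mu := (@lebesgue_measure R).
Variables (G g : R -> R) (a b : R).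
Hypothesis ab : a < b.
Hypothesis G_cont : {within `[a, b], continuous G}.
Hypothesis G_deriv : forall x, x \in `]a, b[ -> is_derive x 1 G (g x).
Hypothesis g_cont : {in `]a, b[, continuous g}.

Let sub_cc u v : a < u -> v < b -> `[u, v] `<=` `]a, b[.
Proof.
move=> au vb x/=; rewrite !in_itv/= => /andP[ux xv].
by rewrite (lt_le_trans au ux) (le_lt_trans xv vb).
Qed.

Let integral_inside u v : a < u -> u < v -> v < b ->
  (\int[mu]_(x in `[u, v]) (g x)%:E = (G v - G u)%:E)%E.
Proof.
move=> au uv vb; have uvab := sub_cc _ _ au vb.
rewrite EFinB; apply: continuous_FTC2 => //.
- apply: continuous_in_subspaceT => x; rewrite inE => /uvab xab.
  exact: g_cont.
- have Gc x : a < x -> x < b -> {for x, continuous G}.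
    move=> ax xb; apply: (is_derive_continuous _ _ _ (g x)).
    by apply: G_deriv; rewrite in_itv/= ax.
  split.
  + move=> x; rewrite in_itv/= => /andP[ux xv].
    have [//] : is_derive x 1 G (g x).
    by apply: G_deriv; rewrite in_itv/= (lt_trans au)//= (lt_trans xv).
  + by apply: cvg_at_right_filter; apply: Gc => //; exact: lt_trans vb.
  + by apply: cvg_at_left_filter; apply: Gc => //; exact: lt_trans uv.
- move=> x; rewrite in_itv/= => /andP[ux xv].
  have [_ <-] : is_derive x 1 G (g x).
    by apply: G_deriv; rewrite in_itv/= (lt_trans au)//= (lt_trans xv).
  by rewrite derive1E.
Qed.

Let mg : measurable_fun `]a, b[ g.
Proof.
by apply: open_continuous_measurable_fun => //; exact/in_continuous_mksetP.
Qed.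

Let itv_bigcup :
  [set` `]a, b[] = \bigcup_n [set` `[a + n.+1%:R^-1, b - n.+1%:R^-1]].
Proof.
apply/seteqP; split => [x/=|x [n _]/=]; rewrite !in_itv/=; last first.
  have : 0 < n.+1%:R^-1 :> R by rewrite invr_gt0.
  by set e := _^-1 => n0 /andP[ax xb]; apply/andP; split; lra.
move=> /andP[ax xb]; pose m := Num.min (x - a) (b - x).
have m0 : 0 < m by rewrite lt_min !subr_gt0 ax xb.
(* This index makes 1/(n + 1) at most the distance m from x to the endpoints. *)
exists (Num.truncn m^-1) => //=; rewrite in_itv/=.
have : (Num.truncn m^-1).+1%:R^-1 <= m :> R.
  by rewrite invf_ple ?posrE//; exact/ltW/truncnS_gt.
by rewrite le_min; set e := _^-1 => /andP[? ?]; apply/andP; split; lra.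
Qed.

(** Monotone convergence along the intervals of [itv_bigcup]: on each, the integral is an increment
    of [G], at most G b - G a because [G] is nondecreasing. *)
Lemma ge0_derivative_integrable : (forall x, x \in `]a, b[ -> 0 <= g x) ->
  mu.-integrable `[a, b] (EFin \o g).
Proof.
move=> g0; apply/integrableP.
have mgc : measurable_fun `[a, b] (EFin \o g).
  by apply/measurable_EFinP; apply: measurable_fun_itv_cc; exact: mg.
split => //.
have mgo : measurable_fun `]a, b[ (fun x => (g x)%:E).
  exact/measurable_EFinP.
rewrite -integral_itv_bndo_bndc; last first.
  apply: measurableT_comp => //; apply/measurable_EFinP.
  by apply: measurable_fun_itv_co; exact: mg.
rewrite -integral_itv_obnd_cbnd; last exact: measurableT_comp.
under eq_integral => x xab.
  rewrite gee0_abs; last by rewrite lee_fin g0//; rewrite inE in xab.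
  over.
rewrite itv_bigcup.
set F := fun n : nat => [set` `[a + n.+1%:R^-1, b - n.+1%:R^-1]].
have Fab n : F n `<=` `]a, b[.
  by rewrite itv_bigcup => x Fx; exists n.
have cvgF : (\int[mu]_(x in F i) (g x)%:E)%E @[i --> \oo] -->
    (\int[mu]_(x in \bigcup_i F i) (g x)%:E)%E.
  apply: ge0_nondecreasing_set_cvg_integral.
  - apply/nondecreasing_seqP => n; rewrite subsetEset => x.
    rewrite /F/= !in_itv/=.
    have H : n.+2%:R^-1 <= n.+1%:R^-1 :> R by rewrite lef_pV2 ?posrE// ler_nat.
    set e := _^-1 in H *; set e' := _^-1 in H *.
    by move=> /andP[? ?]; apply/andP; split; lra.
  - by move=> n; exact: measurable_itv.
  - by move=> n; apply: measurable_funS mgo.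
  - by move=> n x /Fab xab; rewrite lee_fin g0.
have GG : {in `[a, b] &, {homo G : x y / x <= y}}.
  apply: ger0_derive1_le_cc => //.
  - by move=> x /G_deriv [].
  - by move=> x xab; have [_ e] := G_deriv _ xab; rewrite derive1E e g0.
apply: (@le_lt_trans _ _ (G b - G a)%:E); last exact: ltry.
apply: (cvge_to_le cvgF) => //; near=> n.
have n0 : 0 < n.+1%:R^-1 :> R by rewrite invr_gt0.
(* For small n the interval may be a point or empty; the integral over it is then 0. *)
rewrite /F; have [lt|ge] := ltP (a + n.+1%:R^-1) (b - n.+1%:R^-1).
  rewrite integral_inside ?ltrDl ?ltrBlDr ?ltrDl//.
  set e := _^-1 in n0 lt *; rewrite lee_fin.
  by apply: lerB; apply: GG; rewrite ?in_itv/=; try (apply/andP; split); lra.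
have : (0 <= G b - G a)%R.
  by rewrite subr_ge0; apply: GG; rewrite ?in_itv/= ?lexx ltW.
move: ge; rewrite le_eqVlt => /predU1P[->|ge].
  by rewrite set_itv1 integral_set1.
by rewrite set_itv_ge ?bnd_simp -?ltNge// integral_set0.
Unshelve. all: by end_near. Qed.

(* Unlike in [continuous_FTC2], [g] may be unbounded near [a] and [b]. *)
Lemma improper_FTC : mu.-integrable `[a, b] (EFin \o g) ->
  \int[mu]_(x in `[a, b]) g x = G b - G a.
Proof.
move=> ig; pose F x := \int[mu]_(t in `[a, x]) g t.
have F_cont : {within `[a, b], continuous F}.
  exact: (parameterized_integral_continuous (ltW ab) ig).
have F_deriv x : x \in `]a, b[ -> is_derive x 1 F (g x).
  move=> xab; have := xab; rewrite in_itv/= => /andP[ax xb].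
  have [dF FE] := continuous_FTC1_closed xb ig ax (g_cont _ xab).
  by split => //; rewrite -derive1E.
(* [G - F] is continuous on [a, b] with zero derivative inside, so its increment is 0. *)
have [| |c _] := @MVT _ (G - F) (fun=> 0) a b ab.
- move=> x xab; have dG := G_deriv _ xab; have dF := F_deriv _ xab.
  by rewrite -(subrr (g x)); exact: is_deriveB.
- exact: within_continuousB.
rewrite mul0r !fctE/= {2}/F set_itv1 Rintegral_set1 subr0.
by rewrite -/(F b) => e; lra.
Qed.

End ImproperFTC.

(** * Integrability of x^(p-1) and (1-x)^(p-1) on [0, 1] *)

Lemma onem_cvg_at_left (R : realType) : (1 - x) @[x --> (1 : R)^'-] --> (0 : R)^'+.
Proof.
move=> U [e /= e0 HU]; exists e => // x /= xe x1.
by apply: HU; rewrite /= ?subr_gt0// sub0r normrN.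
Qed.

Lemma is_derive_onem_powR (R : realType) (p x : R) : x < 1 ->
  is_derive x 1 (fun y => (1 - y) `^ p) (- (p * (1 - x) `^ (p - 1))).
Proof.
move=> x1; have x1' : 0 < 1 - x by rewrite subr_gt0.
have dB : is_derive x 1 (fun y : R => 1 - y) (- 1).
  by rewrite -sub0r; apply: is_deriveB.
have := @is_derive1_comp _ (fun y => y `^ p) (fun y => 1 - y) _ _ _
  (is_derive1_powR p x1') dB.
by rewrite mulrN1.
Qed.

Section Powers.
Variables (R : realType) (p : R).
Hypothesis p_gt0 : 0 < p.
Notation mu := (@lebesgue_measure R).

(** The power may blow up at 0, but its antiderivative x^p / p is continuous on [0, 1] since p > 0.
    With p = alpha it will dominate w/x. *)
Lemma powR_integrable01 :
  mu.-integrable `[0, 1] (EFin \o (fun x => x `^ (p - 1))).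
Proof.
have der (x : R) : x \in `]0, 1[ ->
    is_derive x 1 (fun y => p^-1 * y `^ p) (x `^ (p - 1)).
  rewrite in_itv/= => /andP[x0 x1]; have dp := is_derive1_powR p x0.
  have := is_deriveZ p^-1 dp.
  by rewrite [_ *: _]mulKf ?gt_eqF.
apply: (ge0_derivative_integrable _ _ _ _ _ ltr01 _ der) => //.
- apply/(continuous_within_itvP _ ltr01); split.
  + by move=> x /der/is_derive_continuous.
  + rewrite powR0 ?gt_eqF// mulr0 -[X in _ --> X](mulr0 p^-1).
    by apply: cvgMl_tmp; exact: powR_cvg0.
  + apply: cvg_at_left_filter; apply: cvgMl_tmp.
    exact: (is_derive_continuous _ _ _ _ (is_derive1_powR p ltr01)).
- move=> x; rewrite in_itv/= => /andP[x0 _].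
  exact: (is_derive_continuous _ _ _ _ (is_derive1_powR _ x0)).
- by move=> x _; exact: powR_ge0.
Qed.

Lemma onem_powR_integrable01 :
  mu.-integrable `[0, 1] (EFin \o (fun x => (1 - x) `^ (p - 1))).
Proof.
have der (x : R) : x \in `]0, 1[ ->
    is_derive x 1 (fun y => - p^-1 * (1 - y) `^ p) ((1 - x) `^ (p - 1)).
  rewrite in_itv/= => /andP[x0 x1].
  have := is_deriveZ (- p^-1) (is_derive_onem_powR R p x x1).
  by rewrite [_ *: _]mulrNN mulKf ?gt_eqF.
apply: (ge0_derivative_integrable _ _ _ _ _ ltr01 _ der) => //.
- apply/(continuous_within_itvP _ ltr01); split.
  + by move=> x /der/is_derive_continuous.
  + apply: cvg_at_right_filter; apply: cvgMl_tmp.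
    exact: (is_derive_continuous _ _ _ _ (is_derive_onem_powR R p 0 ltr01)).
  + rewrite subrr powR0 ?gt_eqF// mulr0 -[X in _ --> X](mulr0 (- p^-1)).
    apply: cvgMl_tmp.
    exact: (@cvg_comp _ _ _ (fun y => 1 - y) (fun y => y `^ p) _ _ _
      (onem_cvg_at_left R) (powR_cvg0 p_gt0)).
- move=> x; rewrite in_itv/= => /andP[_ x1].
  exact: (is_derive_continuous _ _ _ _ (is_derive_onem_powR R (p - 1) x x1)).
- by move=> x _; exact: powR_ge0.
Qed.

End Powers.

(** * Integrals of polynomials against an integrable function *)

Section Moments.
Variables (R : realType) (u : R -> R).
Notation mu := (@lebesgue_measure R).
Hypothesis u_int : mu.-integrable `[0, 1] (EFin \o u).

Lemma integrable_horner (f : {poly R}) :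
  mu.-integrable `[0, 1] (EFin \o (fun x => f.[x] * u x)).
Proof.
have cf : {within `[0, 1], continuous (horner f)}.
  exact/continuous_subspaceT/continuous_horner.
apply: eq_integrable (integrableMr _ _ _ u_int) => //.
- exact: subspace_continuous_measurable_fun.
- have /compact_bounded[M [Mr HM]] := continuous_compact cf (@segment_compact _ 0 1).
  exists M; split => // N MN x xI; apply: (HM _ MN); by exists x.
Qed.

Lemma moment_functional :
  exists L : {scalar {poly R}}, forall f, L f = integral01 (fun x => f.[x] * u x).
Proof.
pose L (f : {poly R}) := integral01 (fun x => f.[x] * u x).
have L_lin : scalar L.
  move=> k f g; rewrite /L /integral01.
  rewrite -RintegralZl//; last exact: integrable_horner.
  rewrite -RintegralD//; last exact: integrable_horner.
    by apply: eq_Rintegral => x _; rewrite hornerD hornerZ mulrDl mulrA.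
  apply: eq_integrable (integrable_horner (k *: f)) => // x _ /=.
  by rewrite hornerZ mulrA.
pose Ls : {scalar {poly R}} := HB.pack L (GRing.isLinear.Build _ _ _ _ L L_lin).
by exists Ls.
Qed.

End Moments.

(** * The weight: regularity, integration by parts, positivity *)

Lemma powRB1 (R : realType) (x p : R) : 0 < x -> x `^ (p - 1) = x `^ p / x.
Proof.
by move=> x0; rewrite powRB ?powRr1 ?(ltW x0)// (gt_eqF x0) implybT.
Qed.

Lemma finite_roots (R : idomainType) (f : {poly R}) :
  f != 0 -> finite_set [set x | f.[x] = 0].
Proof.
move=> f0; apply: contrapT => /(infinite_set_fset (size f))[B BS Bf].
have : (size (finmap.enum_fset B) < size f)%N.
  apply: max_poly_roots => //; last exact: finmap.fset_uniq.
  by apply/allP => x xB; apply/rootP/BS.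
by rewrite ltnNge Bf.
Qed.

Section Weight.
Variables (R : realType) (alpha beta t : R).
Hypotheses (alpha_gt0 : 0 < alpha) (beta_gt0 : 0 < beta) (t_ge0 : 0 <= t).
Notation mu := (@lebesgue_measure R).
Let w := weight alpha beta t.

(** Since [- t / 0] is 0, the exponential factor is 1 at 0; it is the factor 0^alpha that
    vanishes. *)
Let w0 : w 0 = 0.
Proof. by rewrite /w /weight powR0 ?gt_eqF// mulr0 mul0r. Qed.

Let w1 : w 1 = 0.
Proof. by rewrite /w /weight subrr powR0 ?gt_eqF// mulr0. Qed.

Let w_gt0 (x : R) : 0 < x -> x < 1 -> 0 < w x.
Proof. by move=> x0 x1; rewrite !mulr_gt0 ?expR_gt0 ?powR_gt0// subr_gt0. Qed.

Let w_ge0 x : 0 <= w x.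
Proof. by rewrite !mulr_ge0 ?expR_ge0 ?powR_ge0. Qed.

Let expR_le1 (x : R) : 0 <= x -> expR (- t / x) <= 1.
Proof.
by move=> x0; rewrite -[leRHS]expR0 ler_expR mulNr oppr_le0 divr_ge0.
Qed.

Let powR_le1 (x p : R) : 0 <= x -> x <= 1 -> 0 < p -> x `^ p <= 1.
Proof.
by move=> x0 x1 p0; rewrite (le_trans (ge0_ler_powR (ltW p0) _ _ x1)) ?nnegrE// powR1.
Qed.

Let w_le_alpha (x : R) : 0 <= x -> x <= 1 -> w x <= x `^ alpha.
Proof.
move=> x0 x1; rewrite /w /weight -[leRHS]mulr1 -[leRHS]mul1r mulrA.
rewrite !ler_pM ?mulr_ge0 ?expR_ge0 ?powR_ge0 ?expR_le1//.
by apply: powR_le1 => //; lra.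
Qed.

Let w_le_beta (x : R) : 0 <= x -> x <= 1 -> w x <= (1 - x) `^ beta.
Proof.
move=> x0 x1; rewrite /w /weight -[leRHS]mul1r.
rewrite ler_pM ?mulr_ge0 ?expR_ge0 ?powR_ge0//.
by rewrite -[leRHS]mul1r ler_pM ?expR_ge0 ?powR_ge0 ?expR_le1 ?powR_le1.
Qed.

Lemma is_derive_weight (x : R) : 0 < x -> x < 1 ->
  is_derive x 1 w (w x * (alpha / x + t / x ^+ 2 - beta / (1 - x))).
Proof.
move=> x0 x1; have xn0 : x != 0 by rewrite gt_eqF.
have xn1 : 1 - x != 0 by rewrite gt_eqF// subr_gt0.
have d1 := is_derive1_powR alpha x0.
have d2 : is_derive x 1 (fun y => (1 - y) `^ beta) _ := is_derive_onem_powR _ _ _ x1.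
have dV : is_derive x 1 (fun y : R => y^-1) (- x ^- 2 *: 1).
  by apply: (is_deriveV (f := id)).
have dt := is_deriveZ (- t) dV.
have de := @is_derive1_comp _ expR _ _ _ _ (is_derive_expR _) dt.
have := is_deriveM (is_deriveM de d1) d2.
move=> /(@is_derive_eq _ _ _ _ _ _ _); apply.
rewrite /w /weight !fctE /= /GRing.scale/= mulr1 !powRB1 ?subr_gt0//.
by field; rewrite xn1.
Qed.

(** At the endpoints w is squeezed between 0 and x^alpha, respectively (1 - x)^beta. *)
Lemma weight_continuous : {within `[0, 1], continuous w}.
Proof.
apply/(continuous_within_itvP _ ltr01); split.
- move=> x; rewrite in_itv/= => /andP[x0 x1].
  exact: is_derive_continuous (is_derive_weight _ x0 x1).
- rewrite w0; apply: (squeeze_cvgr _ (cvg_cst 0) (powR_cvg0 alpha_gt0)).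
  near=> x; rewrite w_ge0 w_le_alpha//.
  near: x; exact: nbhs_right_le.
- rewrite w1; apply: (squeeze_cvgr (h := fun x => (1 - x) `^ beta) _ (cvg_cst 0)).
    near=> x; rewrite w_ge0 w_le_beta//.
    near: x; exact: nbhs_left_ge.
  exact: (@cvg_comp _ _ _ (fun y => 1 - y) (fun y => y `^ beta) _ _ _
    (onem_cvg_at_left R) (powR_cvg0 beta_gt0)).
Unshelve. all: by end_near. Qed.

Lemma weight_integrable : mu.-integrable `[0, 1] (EFin \o w).
Proof.
exact: continuous_compact_integrable (@segment_compact _ 0 1) weight_continuous.
Qed.

Let w_measurable : measurable_fun `[0 : R, 1] w.
Proof. exact: subspace_continuous_measurable_fun weight_continuous. Qed.

(** Dominated by x^(alpha - 1), because w is at most x^alpha; this covers t = 0 as well. *)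
Lemma weight_div_integrable :
  mu.-integrable `[0, 1] (EFin \o (fun x => w x / x)).
Proof.
apply: le_integrable (powR_integrable01 _ _ alpha_gt0) => //.
  apply/measurable_EFinP; apply: measurable_funM => //.
  apply: (@eq_measurable_fun _ _ _ _ _ (fun x : R => x `^ (- 1))).
    by move=> x; rewrite inE/= in_itv/= => /andP[x0 _]; rewrite powR_inv1.
  exact: measurable_funS (measurable_powR _).
move=> x/=; rewrite in_itv/= => /andP[x0 x1].
rewrite lee_fin !ger0_norm ?divr_ge0 ?powR_ge0//.
move: x0; rewrite le_eqVlt => /predU1P[<-|x0]; first by rewrite w0 mul0r powR_ge0.
by rewrite powRB1// ler_pM2r ?invr_gt0// w_le_alpha// ltW.
Qed.

Lemma weight_div_onem_integrable :
  mu.-integrable `[0, 1] (EFin \o (fun x => w x / (1 - x))).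
Proof.
apply: le_integrable (onem_powR_integrable01 _ _ beta_gt0) => //.
  apply/measurable_EFinP; apply: measurable_funM => //.
  apply: (@eq_measurable_fun _ _ _ _ _ (fun x : R => (1 - x) `^ (- 1))).
    move=> x; rewrite inE/= in_itv/= => /andP[_ x1].
    by rewrite powR_inv1 ?subr_ge0.
  apply: (measurableT_comp (measurable_powR _)).
  exact: measurable_funB.
move=> x/=; rewrite in_itv/= => /andP[x0 x1].
rewrite lee_fin !ger0_norm ?divr_ge0 ?powR_ge0 ?subr_ge0//.
move: x1; rewrite le_eqVlt => /predU1P[->|x1].
  by rewrite w1 mul0r powR_ge0.
have x1' : 0 < 1 - x by rewrite subr_gt0.
by rewrite powRB1// ler_pM2r ?invr_gt0// w_le_beta// ltW.
Qed.

Lemma weight_by_parts (f : {poly R}) :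
  integral01 (fun x => ('X * f)^`().[x] * w x) =
  - (alpha + beta) * integral01 (fun x => f.[x] * w x)
  - t * integral01 (fun x => f.[x] * (w x / x))
  + beta * integral01 (fun x => f.[x] * (w x / (1 - x))).
Proof.
(* The derivative of x f w is A + B - C: writing x/(1 - x) = 1/(1 - x) - 1 moves a [beta] into the
   coefficient of f w. *)
pose A x := (('X * f)^`() + (alpha + beta) *: f).[x] * w x.
pose B x := (t *: f).[x] * (w x / x).
pose C x := (beta *: f).[x] * (w x / (1 - x)).
have iA : mu.-integrable `[0, 1] (EFin \o A).
  exact: integrable_horner weight_integrable _.
have iB : mu.-integrable `[0, 1] (EFin \o B).
  exact: integrable_horner weight_div_integrable _.
have iC : mu.-integrable `[0, 1] (EFin \o C).
  exact: integrable_horner weight_div_onem_integrable _.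
have iAB : mu.-integrable `[0, 1] (EFin \o (fun x => A x + B x)).
  by apply: eq_integrable (integrableD _ iA iB).
have iABC : mu.-integrable `[0, 1] (EFin \o (fun x => A x + B x - C x)).
  by apply: eq_integrable (integrableB _ iAB iC).
have der (x : R) : x \in `]0, 1[ ->
    is_derive x 1 (fun y => ('X * f).[y] * w y) (A x + B x - C x).
  rewrite in_itv/= => /andP[x0 x1].
  have := is_deriveM (is_derive_poly ('X * f) x) (is_derive_weight _ x0 x1).
  move=> /(@is_derive_eq _ _ _ _ _ _ _); apply; rewrite /A /B /C.
  move: (w x) => W; rewrite !hornerE /GRing.scale/=; field.
  by rewrite !gt_eqF// subr_gt0.
have cABC : {in `]0, 1[, continuous (fun x => A x + B x - C x)}.
  move=> x; rewrite in_itv/= => /andP[x0 x1].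
  have cw := is_derive_continuous _ _ _ _ (is_derive_weight _ x0 x1).
  have ch (p : {poly R}) : {for x, continuous (horner p)}.
    exact: continuous_horner.
  apply: cvgB; first apply: cvgD; apply: cvgM => //; first exact: ch.
  - exact: ch.
  - by apply: cvgM => //; apply: cvgV => //; rewrite gt_eqF.
  - exact: ch.
  - apply: cvgM => //; apply: cvgV; first by rewrite gt_eqF// subr_gt0.
    by apply: cvgB => //; exact: cvg_cst.
have cF : {within `[0, 1], continuous (fun y => ('X * f).[y] * w y)}.
  move=> x; apply: cvgM; last exact: weight_continuous.
  exact: (continuous_subspaceT (@continuous_horner _ _)).
have := improper_FTC _ _ _ _ _ ltr01 cF der cABC iABC.
(* The boundary terms vanish with w. *)
rewrite w0 w1 !mulr0 subr0 RintegralB// RintegralD//.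
have [L LE] := moment_functional _ _ weight_integrable.
have [E EE] := moment_functional _ _ weight_div_integrable.
have [D DE] := moment_functional _ _ weight_div_onem_integrable.
rewrite -[\int[mu]_(x in _) A x]LE -[\int[mu]_(x in _) B x]EE.
rewrite -[\int[mu]_(x in _) C x]DE -!LE -EE -DE linearD !linearZ/= => e.
by apply/eqP; rewrite -subr_eq0 -e /GRing.scale/=; apply/eqP; ring.
Qed.

(** If the integral were 0, the nonnegative f^2 w would vanish almost everywhere. As w > 0 inside,
    ]0, 1[ would be covered by a null set and the finitely many roots of f, against its measure
    1. *)
Lemma weight_moment_neq0 (f : {poly R}) : f != 0 ->
  integral01 (fun x => (f * f).[x] * w x) != 0.
Proof.
move=> f0; apply/negP => /eqP I0.
have iff := integrable_horner _ _ weight_integrable (f * f).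
have ff_ge0 x : 0 <= (f * f).[x] * w x by rewrite mulr_ge0// hornerM -expr2 sqr_ge0.
have I0' : (\int[mu]_(x in `[0%R, 1%R]) `|((f * f).[x] * w x)%:E| = 0)%E.
  under eq_integral => x _ do rewrite gee0_abs ?lee_fin//.
  rewrite -[LHS]fineK; last exact: integrable_fin_num iff.
  by rewrite -[fine _]/(integral01 _) I0.
have [A [mA muA NA]] :=
  (ae_eq_integral_abs mu (measurable_itv _) (measurable_int mu iff)).1 I0'.
pose Z := [set x | f.[x] = 0].
have cZ : countable Z by apply: finite_set_countable; exact: finite_roots.
have sub : `]0, 1[ `<=` A `|` Z.
  move=> x /=; rewrite in_itv/= => /andP[x0 x1].
  have [fx|fx] := eqVneq f.[x] 0; [by right|left].
  apply: NA => /=; rewrite in_itv/= !ltW// => /(_ isT) [] /eqP.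
  by rewrite hornerM mulf_eq0 (gt_eqF (w_gt0 _ x0 x1)) orbF mulf_eq0 (negPf fx).
have : (mu `]0%R, 1%R[ <= mu (A `|` Z))%E.
  rewrite le_measure ?inE//.
  by apply: measurableU => //; exact: countable_measurable.
rewrite measureU0//; [|exact: countable_measurable|exact: countable_lebesgue_measure0].
rewrite muA lebesgue_measure_itv/= lte01 oppr0 adde0.
by rewrite leNgt lte01.
Qed.

End Weight.

(** * Transfer of the algebraic identity to the weight *)

Theorem lemma3p4 (R : realType) (alpha beta t : R)
    (P : nat -> {poly R}) (h a b : nat -> R)
    (alpha_gt0 : 0 < alpha) (beta_gt0 : 0 < beta) (t_ge0 : 0 <= t)
    (P_orth : monic_orthogonal (weight alpha beta t) P h)
    (P_rec : recurrence_coefficients P a b) (n : nat) :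
  let r := r_aux alpha beta t P h in
  let rs := r_star alpha beta t P h in
  (1 - (2 * n%:R + alpha + beta) ^+ 2) * b n =
  - (rs n - r n) ^+ 2 - (beta + t) * r n
  + (t - alpha - 2 * n%:R) * rs n + n%:R * t.
Proof.
move=> r rs.
have iw := weight_integrable R alpha beta t alpha_gt0 beta_gt0 t_ge0.
have iE := weight_div_integrable R alpha beta t alpha_gt0 beta_gt0 t_ge0.
have iD := weight_div_onem_integrable R alpha beta t alpha_gt0 beta_gt0 t_ge0.
have [L LE] := moment_functional _ _ iw.
have [E EE] := moment_functional _ _ iE.
have [D DE] := moment_functional _ _ iD.
have [P_monic_size P_int] := P_orth.
have [b0 P_rec'] := P_rec.
have by_parts f : L ('X * f)^`() = - (alpha + beta) * L f - t * E f + beta * D f.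
  by rewrite !LE EE DE weight_by_parts.
have EX f : E ('X * f) = L f.
  rewrite EE LE; apply: eq_Rintegral => x _; rewrite hornerM hornerX.
  (* At x = 0 the quotient x / x is 0 rather than 1, but both sides vanish with w. *)
  have [->|x0] := eqVneq x 0; last by move: (weight _ _ _ _) => W; field.
  by rewrite /weight powR0 ?gt_eqF// !(mulr0, mul0r).
have DX f : D ('X * f) = D f - L f.
  (* The factor 1 - x of f - x f cancels the denominator, and at x = 1 the weight is 0. *)
  suff -> : L f = D (f - 'X * f) by rewrite linearB/=; ring.
  rewrite DE LE; apply: eq_Rintegral => x _.
  rewrite hornerD hornerN hornerM hornerX.
  have [x1|x1] := eqVneq (1 - x) 0; last by move: (weight _ _ _ _) => W; field.
  by rewrite /weight x1 powR0 ?gt_eqF// !(mulr0, mul0r).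
have P_orthL m k : L (P m * P k) = if m == k then h k else 0.
  by rewrite LE -P_int; apply: eq_Rintegral => x _; rewrite hornerM.
have h_neq0 k : h k != 0.
  have <- : L (P k * P k) = h k by rewrite P_orthL eqxx.
  by rewrite LE weight_moment_neq0// monic_neq0// (P_monic_size k).1.
have := orthogonal_recurrence R L E D alpha beta t by_parts EX DX P h a b
  (fun k => (P_monic_size k).1) (fun k => (P_monic_size k).2)
  P_orthL b0 P_rec' h_neq0 n.
have -> : rs n = if n is m.+1 then t / h m * E (P m * P n) else 0.
  rewrite /rs /r_star; case: n => // m; rewrite EE; congr (_ * _).
  by apply: eq_Rintegral => x _; rewrite hornerM !mulrA.
have -> : r n = if n is m.+1 then beta / h m * D (P m * P n) else 0.
  rewrite /r /r_aux; case: n => // m; rewrite DE; congr (_ * _).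
  by apply: eq_Rintegral => x _; rewrite hornerM !mulrA.
by [].
Qed.
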